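(* Consider the stochastic primal-dual hybrid gradient (SPDHG) method described in the context, run with step-sizes $\beta^{k+1} = \frac{1}{\sqrt{k+1}+L}$ and uniform averaging weights $\alpha^{k+1} = \frac{1}{t+1}$, $k=0,\dots,t$. Let $(y^*,x^* )$ be any saddle point of $\min_{x\in\mathcal{X}}\max_{y\in\mathcal{Y}} P(y,x)$. Then for every $t\ge 0$, $$0\le \mathbb{E}\left[P(y^*,\bar{x}^t) - P(\bar{y}^t,x^* )\right] \le \frac{D_y^2}{2s(t+1)} + \frac{L D_x^2}{2(t+1)} + \frac{D_x^2+2\lambda_{\max}(F^\top F)D_y^2+2\sigma^2}{\sqrt{t+1}},$$ i.e. $(\bar y^t,\bar x^t)$ converges to the saddle point at rate $O(1/\sqrt{t})$ in expectation.
   Context: Setting: $\mathcal{X}\subset\mathbb{R}^d$ is a nonempty convex compact set with diameter $D_x$ (so $\|x-x'\|\le D_x$ for all $x,x'\in\mathcal{X}$), $\mathcal{Y}\subset\mathbb{R}^l$ is a nonempty convex compact set with diameter $D_y$, $F\in\mathbb{R}^{l\times d}$, and $\lambda_{\max}(F^\top F)$ denotes the largest eigenvalue of $F^\top F$. The regularizer is $r(z)=\max_{y\in\mathcal{Y}}\langle y,z\rangle$. The loss is $l(x)=\mathbb{E}_\xi[l(x,\xi)]$, a convex, continuously differentiable function on $\mathcal{X}$ with $L$-Lipschitz gradient: $\|\nabla l(x_1)-\nabla l(x_2)\|\le L\|x_1-x_2\|$ for all $x_1,x_2\in\mathcal{X}$. The stochastic gradient $\nabla l(x,\xi)$ satisfies,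 for every $x\in\mathcal{X}$: $\mathbb{E}[\nabla l(x,\xi)]=\nabla l(x)$, $\mathbb{E}\|\nabla l(x,\xi)-\nabla l(x)\|^2\le\sigma^2$, and $\mathbb{E}\exp\left(\|\nabla l(x,\xi)-\nabla l(x)\|^2/\sigma^2\right)\le \exp(1)$, for a constant $\sigma>0$. The saddle function is $P(y,x)=l(x)+\langle y,Fx\rangle$ for $x\in\mathcal{X},y\in\mathcal{Y}$; a saddle point $(y^*,x^* )$ satisfies $P(y,x^* )\le P(y^*,x^* )\le P(y^*,x)$ for all $(y,x)\in\mathcal{Y}\times\mathcal{X}$ (assumed to exist). SPDHG: fix $s>0$, $x^0\in\mathcal{X}$, $y^0\in\mathcal{Y}$, and a sequence of step-sizes $\beta^{k+1}>0$. For $k=0,1,2,\dots$, draw a sample $\xi^{k+1}$ independently of the past (i.i.d. samples), and set $$y^{k+1}=\arg\max_{y\in\mathcal{Y}}\Big\{P(y,x^k)-\tfrac{1}{2s}\|y-y^k\|^2\Big\},\qquad x^{k+1}=\Pi_{\mathcal{X}}\Big[x^k-\beta^{k+1}\big(\nabla l(x^k,\xi^{k+1})+F^\top y^{k+1}\big)\Big],$$ where $\Pi_{\mathcal{X}}$ is Euclidean projection onto $\mathcal{X}$. Given weights $\alpha^{k+1}\ge0$ with $\sum_{k=0}^t\alpha^{k+1}=1$, the output after $t$ steps is $\bar x^t=\sum_{k=0}^t\alpha^{k+1}x^{k+1}$, $\bar y^t=\sum_{k=0}^t\alpha^{k+1}y^{k+1}$. *)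

(* Defs.v *)
From HB Require Import structures.
From mathcomp Require Import all_boot all_order all_algebra.
From mathcomp Require Import all_classical all_reals all_analysis.
Set Implicit Arguments. Unset Strict Implicit. Unset Printing Implicit Defensive.
Import Order.TTheory GRing.Theory Num.Theory numFieldNormedType.Exports.
Local Open Scope ring_scope.
Local Open Scope classical_set_scope.

Definition dotv {R : realType} {n : nat} (u v : 'cV[R]_n) : R :=
  \sum_(i < n) u i 0 * v i 0.

Definition enorm {R : realType} {n : nat} (u : 'cV[R]_n) : R :=
  Num.sqrt (dotv u u).

Definition convex_set_ {R : realType} {n : nat} (A : set 'cV[R]_n) : Prop :=
  forall x y, A x -> A y -> forall th : R, 0 <= th <= 1 ->
    A (th *: x + (1 - th) *: y).

Definition convex_on {R : realType} {n : nat} (A : set 'cV[R]_n)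
  (f : 'cV[R]_n -> R) : Prop :=
  forall x y, A x -> A y -> forall th : R, 0 <= th <= 1 ->
    f (th *: x + (1 - th) *: y) <= th * f x + (1 - th) * f y.

Definition Psad {R : realType} {d l : nat} (loss : 'cV[R]_d -> R)
  (F : 'M[R]_(l, d)) (y : 'cV[R]_l) (x : 'cV[R]_d) : R :=
  loss x + dotv y (F *m x).

Definition is_lambda_max {R : realType} {n : nat} (M : 'M[R]_n) (lam : R) : Prop :=
  eigenvalue M lam /\ forall a, eigenvalue M a -> a <= lam.

Definition measurable_vec {R : realType} {n : nat} {dT : measure_display}
  {T : measurableType dT} (X : T -> 'cV[R]_n) : Prop :=
  forall i : 'I_n, measurable_fun setT (fun w => X w i 0).

(* Joint (Borel x Xi) measurability of the stochastic gradient map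
   (x, xi) |-> G x xi, expressed as: composing with any measurable pair of
   maps (X, Z) yields a measurable map. *)
Definition jointly_measurable {R : realType} {n : nat} {dX : measure_display}
  {Xi : measurableType dX} (G : 'cV[R]_n -> Xi -> 'cV[R]_n) : Prop :=
  forall (dT : measure_display) (T : measurableType dT)
    (X : T -> 'cV[R]_n) (Z : T -> Xi),
    measurable_vec X -> measurable_fun setT Z ->
    measurable_vec (fun w => G (X w) (Z w)).

Definition mutually_independent {R : realType} {dT : measure_display}
  {T : measurableType dT} (P : probability T R) {dX : measure_display}
  {Xi : measurableType dX} (xi : nat -> T -> Xi) : Prop :=
  (forall k, measurable_fun setT (xi k)) /\
  forall (s : seq nat) (B : nat -> set Xi), uniq s ->
    (forall k, measurable (B k)) ->
    P (\big[setI/setT]_(k <- s) (xi k @^-1` B k)) =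
    (\prod_(k <- s) P (xi k @^-1` B k))%E.

Definition identically_distributed {R : realType} {dT : measure_display}
  {T : measurableType dT} (P : probability T R) {dX : measure_display}
  {Xi : measurableType dX} (xi : nat -> T -> Xi) (mu : probability Xi R) : Prop :=
  forall k (A : set Xi), measurable A -> P (xi k @^-1` A) = mu A.

(* Step sizes beta^{k+1} = 1 / (sqrt(k+1) + L). *)
Definition beta_step {R : realType} (L : R) (k : nat) : R :=
  1 / (Num.sqrt (k.+1)%:R + L).

Definition avg {R : realType} {n : nat} (v : nat -> 'cV[R]_n) (t : nat) : 'cV[R]_n :=
  (t.+1%:R)^-1 *: \sum_(k < t.+1) v k.+1.

(* Main.v *)
(* Each step is two Euclidean projections, whose variational inequalities are combined with
   the descent lemma and the tangent inequality for [loss].  With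
   [1 / beta_k = r_k + L], the curvature term [L/2 |x' - x|^2] is absorbed and the remaining
   [- r_k / 2 |x' - x|^2] pays, by Young's inequality, for the gradient noise and for the lag
   [<ys - y', F (x' - x)>], leaving [(|noise|^2 + lam Dy^2) / r_k].  Summation telescopes the
   distances to the saddle point, and [r_k = sqrt (k+1)] gives
   [sum_k 1 / r_k <= 2 sqrt (t+1)].
   The cross terms [<noise_k, xs - x_k>] have mean zero because [x_k] is measurable for the
   sigma-algebra generated by [xi_1, ..., xi_k], which is independent of [xi_(k+1)]. *)
Require Import Defs.
From HB Require Import structures.
From mathcomp Require Import all_boot all_order all_algebra.
From mathcomp Require Import all_classical all_reals all_analysis.
From mathcomp Require Import measurable_realfun.
From mathcomp Require Import ring lra.
Set Implicit Arguments.
Unset Strict Implicit.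
Unset Printing Implicit Defensive.
Import Order.TTheory GRing.Theory Num.Theory numFieldNormedType.Exports.
Local Open Scope ring_scope.
Local Open Scope classical_set_scope.

(** * Euclidean geometry and projections *)

Section InnerProduct.
Context {R : realType} {n : nat}.
Implicit Types (u v w : 'cV[R]_n) (c : R).

Lemma dotvC u v : dotv u v = dotv v u.
Proof. by apply: eq_bigr => i _; rewrite mulrC. Qed.

Lemma dotvDl u v w : dotv (u + v) w = dotv u w + dotv v w.
Proof. by rewrite -big_split; apply: eq_bigr => i _; rewrite mxE mulrDl. Qed.

Lemma dotvZl c u w : dotv (c *: u) w = c * dotv u w.
Proof. by rewrite mulr_sumr; apply: eq_bigr => i _; rewrite mxE mulrA. Qed.

Lemma dotvNl u w : dotv (- u) w = - dotv u w.
Proof. by rewrite -scaleN1r dotvZl mulN1r. Qed.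

Lemma dotvDr w u v : dotv w (u + v) = dotv w u + dotv w v.
Proof. by rewrite !(dotvC w) dotvDl. Qed.

Lemma dotvZr c w u : dotv w (c *: u) = c * dotv w u.
Proof. by rewrite !(dotvC w) dotvZl. Qed.

Lemma dotvNr w u : dotv w (- u) = - dotv w u.
Proof. by rewrite !(dotvC w) dotvNl. Qed.

Lemma dotv0l w : dotv 0 w = 0.
Proof. by rewrite -(scale0r 0) dotvZl mul0r. Qed.

Lemma dotv_suml (I : Type) (r : seq I) (f : I -> 'cV[R]_n) w :
  dotv (\sum_(i <- r) f i) w = \sum_(i <- r) dotv (f i) w.
Proof.
by elim/big_rec2: _ => [|i y1 y2 _ <-]; [exact: dotv0l|rewrite dotvDl].
Qed.

Lemma sqr_coord_le_dotv u i : u i 0 ^+ 2 <= dotv u u.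
Proof.
rewrite /dotv (bigD1 i) //= expr2 lerDl.
by apply: sumr_ge0 => j _; rewrite -expr2 sqr_ge0.
Qed.

Lemma dotv_ge0 u : 0 <= dotv u u.
Proof. by apply: sumr_ge0 => i _; rewrite -expr2 sqr_ge0. Qed.

Lemma dotv_eq0 u : (dotv u u == 0) = (u == 0).
Proof.
apply/eqP/eqP => [u0|->]; last exact: dotv0l.
apply/colP => i; rewrite mxE; apply/eqP; rewrite -sqrf_eq0 eq_le sqr_ge0 andbT.
by rewrite -u0 sqr_coord_le_dotv.
Qed.

Lemma dotv_gt0 u : (0 < dotv u u) = (u != 0).
Proof. by rewrite lt_def dotv_eq0 dotv_ge0 andbT. Qed.

Lemma enorm_sqr u : enorm u ^+ 2 = dotv u u.
Proof. by rewrite sqr_sqrtr // dotv_ge0. Qed.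

Lemma enorm_ge0 u : 0 <= enorm u.
Proof. exact: sqrtr_ge0. Qed.

Lemma enorm_gt0 u : (0 < enorm u) = (u != 0).
Proof. by rewrite sqrtr_gt0 dotv_gt0. Qed.

Lemma enormN u : enorm (- u) = enorm u.
Proof. by rewrite /enorm dotvNl dotvNr opprK. Qed.

Lemma enormZ c u : 0 <= c -> enorm (c *: u) = c * enorm u.
Proof.
move=> c0; rewrite /enorm dotvZl dotvZr mulrA -expr2.
by rewrite sqrtrM ?sqr_ge0 // sqrtr_sqr ger0_norm.
Qed.

Lemma norm_coord_le_enorm u i : `|u i 0| <= enorm u.
Proof. by rewrite -sqrtr_sqr ler_wsqrtr // sqr_coord_le_dotv. Qed.

Lemma dotv_le_enormM u v : dotv u v <= enorm u * enorm v.
Proof.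
have [->|v0] := eqVneq v 0; first by rewrite dotvC dotv0l mulr_ge0 ?enorm_ge0.
have vv0 : 0 < dotv v v by rewrite dotv_gt0.
have cauchy_schwarz : dotv u v ^+ 2 <= dotv u u * dotv v v.
  rewrite -(ler_pM2l vv0); have := dotv_ge0 (dotv v v *: u - dotv u v *: v).
  by rewrite !(dotvDl, dotvDr, dotvNl, dotvNr, dotvZl, dotvZr) (dotvC v u); lra.
rewrite -sqrtrM ?dotv_ge0 //; apply: le_trans (ler_wsqrtr cauchy_schwarz).
by rewrite sqrtr_sqr ler_norm.
Qed.

Lemma norm_dotv_le u v : `|dotv u v| <= enorm u * enorm v.
Proof.
by rewrite ler_norml dotv_le_enormM lerNl -dotvNl -(enormN u) dotv_le_enormM.
Qed.

End InnerProduct.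

Definition dotvE := (@dotvDl, @dotvDr, @dotvNl, @dotvNr, @dotvZl, @dotvZr).

Lemma ler_enorm {R : realType} {m n : nat} (u : 'cV[R]_m) (v : 'cV[R]_n) :
  (enorm u <= enorm v) = (dotv u u <= dotv v v).
Proof. by rewrite ler_sqrt // dotv_ge0. Qed.

Lemma dotv_trmx {R : realType} {m n : nat} (A : 'M[R]_(m, n)) (u : 'cV[R]_m)
  (v : 'cV[R]_n) : dotv (A^T *m u) v = dotv u (A *m v).
Proof.
have dotv_mulmxE k (x y : 'cV[R]_k) : dotv x y = (x^T *m y) 0 0.
  by rewrite mxE; apply: eq_bigr => i _; rewrite mxE.
by rewrite !dotv_mulmxE trmx_mul trmxK mulmxA.
Qed.

Lemma le0_of_le_small_multiples {R : realFieldType} (a b : R) :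
  (forall th, 0 < th <= 1 -> a <= th * b) -> a <= 0.
Proof.
move=> le_ab; rewrite leNgt; apply/negP => a0; have b0 : 0 < b.
  by rewrite (lt_le_trans a0) // -[b]mul1r le_ab // ltr01 lexx.
have ab : a <= b by rewrite -[b]mul1r le_ab // ltr01 lexx.
have /le_ab : 0 < a / (2 * b) <= 1.
  by rewrite divr_gt0 ?mulr_gt0 //= ler_pdivrMr ?mulr_gt0 //; lra.
have -> : a / (2 * b) * b = a / 2 by field; rewrite gt_eqF.
lra.
Qed.

Lemma mulr_le_young {R : realFieldType} (a b r : R) :
  0 < r -> a * b <= a ^+ 2 / r + r / 4 * b ^+ 2.
Proof.
move=> r0; rewrite -(ler_pM2r r0) mulrDl divfK ?gt_eqF //.
have := sqr_ge0 (a - r / 2 * b); lra.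
Qed.

Definition diam_le {R : realType} {n : nat} (A : set 'cV[R]_n) (D : R) : Prop :=
  forall x x', A x -> A x' -> enorm (x - x') <= D.

Lemma enorm_sqr_diam_le {R : realType} {n : nat} (A : set 'cV[R]_n) (D : R)
    (x x' : 'cV[R]_n) :
  diam_le A D -> A x -> A x' -> enorm (x - x') ^+ 2 <= D ^+ 2.
Proof.
move=> diamA Ax Ax'; have leD := diamA _ _ Ax Ax'.
by rewrite ler_pXn2r // ?nnegrE ?enorm_ge0 // (le_trans (enorm_ge0 _) leD).
Qed.

Definition is_projection {R : realType} {n : nat} (A : set 'cV[R]_n)
    (v p : 'cV[R]_n) : Prop :=
  A p /\ forall z, A z -> enorm (p - v) <= enorm (z - v).

Section Projection.
Context {R : realType} {n : nat} (A : set 'cV[R]_n).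
Hypothesis convexA : convex_set_ A.

Lemma projection_variational (v p z : 'cV[R]_n) :
  is_projection A v p -> A z -> dotv (z - p) (v - p) <= 0.
Proof.
move=> [Ap min_p] Az; rewrite -(pmulr_rle0 _ (ltr0n _ 2)).
apply: (@le0_of_le_small_multiples _ _ (dotv (z - p) (z - p))) => th th01.
have th0 : 0 < th by case/andP: th01.
have /min_p : A (th *: z + (1 - th) *: p).
  by apply: convexA => //; case/andP: th01 => /ltW -> ->.
have -> : th *: z + (1 - th) *: p - v = th *: (z - p) - (v - p).
  by apply/matrixP => i j; rewrite !mxE; ring.
rewrite -[p - v]opprB ler_enorm; move: (v - p) (z - p) => u w.
by rewrite !dotvE (dotvC u w) -(ler_pM2l th0 (2 * _)) => ?; lra.
Qed.

Lemma projection_nonexpansive (v1 v2 p1 p2 : 'cV[R]_n) :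
  is_projection A v1 p1 -> is_projection A v2 p2 ->
  enorm (p1 - p2) <= enorm (v1 - v2).
Proof.
move=> pr1 pr2; rewrite ler_enorm.
have := projection_variational pr1 pr2.1.
have := projection_variational pr2 pr1.1.
have := dotv_ge0 ((p1 - p2) - (v1 - v2)).
rewrite !dotvE (dotvC v1 p1) (dotvC v2 p1) (dotvC v1 p2) (dotvC v2 p2).
rewrite (dotvC p2 p1) (dotvC v2 v1); lra.
Qed.

Lemma projected_step_le (x g p z : 'cV[R]_n) (b : R) : 0 < b ->
  is_projection A (x - b *: g) p -> A z ->
  dotv g (p - z) <=
    (2 * b)^-1 * (enorm (x - z) ^+ 2 - enorm (p - z) ^+ 2 - enorm (p - x) ^+ 2).
Proof.
move=> b0 /projection_variational/[apply]; have b2 : 0 < 2 * b by rewrite mulr_gt0.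
rewrite -(ler_pM2l b2 (dotv g _)) mulVKf ?gt_eqF // !enorm_sqr !dotvE.
rewrite (dotvC x z) (dotvC z p) (dotvC x p) (dotvC z g) (dotvC p g); lra.
Qed.

End Projection.

(** * Uniform averages and telescoping sums *)

Lemma invr_natS {R : realType} (t : nat) :
  t.+1%:R^-1 = 1 - t%:R / t.+1%:R :> R.
Proof. by rewrite -natr1; field; rewrite natr1 pnatr_eq0. Qed.

Lemma natr_div_natS_itv01 {R : realType} (t : nat) : 0 <= (t%:R / t.+1%:R : R) <= 1.
Proof. by rewrite divr_ge0 //= ler_pdivrMr // mul1r ler_nat. Qed.

Section UniformAverage.
Context {R : realType} {n : nat}.
Implicit Types (v : nat -> 'cV[R]_n) (w : 'cV[R]_n) (A : set 'cV[R]_n).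

Lemma avg0 v : avg v 0 = v 1%N.
Proof. by rewrite /avg big_ord_recl big_ord0 addr0 invr1 scale1r. Qed.

Lemma avgS v (t : nat) :
  avg v t.+1 =
    (t.+1%:R / t.+2%:R) *: avg v t + (1 - t.+1%:R / t.+2%:R) *: v t.+2.
Proof.
by rewrite -invr_natS /avg big_ord_recr /= scalerDr scalerA mulrAC divff ?mul1r //.
Qed.

Lemma convex_set_avg A v (t : nat) :
  convex_set_ A -> (forall k, A (v k.+1)) -> A (avg v t).
Proof.
move=> cA Av; elim: t => [|t IH]; first by rewrite avg0.
by rewrite avgS; apply: cA => //; exact: natr_div_natS_itv01.
Qed.

Lemma convex_on_avg A (f : 'cV[R]_n -> R) v (t : nat) :
  convex_set_ A -> convex_on A f -> (forall k, A (v k.+1)) ->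
  f (avg v t) <= t.+1%:R^-1 * \sum_(k < t.+1) f (v k.+1).
Proof.
move=> cA cf Av; elim: t => [|t IH].
  by rewrite avg0 big_ord_recl big_ord0 addr0 invr1 mul1r.
rewrite avgS; apply: le_trans (cf _ _ _ _ _ (natr_div_natS_itv01 t.+1)) _ => //.
  exact: convex_set_avg.
rewrite -invr_natS [in leRHS]big_ord_recr /= mulrDr lerD2r mulrC.
rewrite -ler_pdivlMr ?divr_gt0 //; apply: le_trans IH _.
by rewrite invf_div mulrAC mulrA mulVf ?mul1r ?pnatr_eq0.
Qed.

Lemma dotv_avgl v w (t : nat) :
  dotv (avg v t) w = t.+1%:R^-1 * \sum_(k < t.+1) dotv (v k.+1) w.
Proof. by rewrite /avg dotvZl dotv_suml. Qed.

End UniformAverage.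

Lemma mulmx_avg {R : realType} {m n : nat} (A : 'M[R]_(m, n))
    (v : nat -> 'cV[R]_n) (t : nat) :
  A *m avg v t = avg (fun k => A *m v k) t.
Proof. by rewrite /avg -scalemxAr mulmx_sumr. Qed.

Lemma telescope_weighted_le {R : realFieldType} (a b : nat -> R) (M : R) (t : nat) :
  (forall k, 0 <= b k <= b k.+1) -> (forall k, 0 <= a k <= M) ->
  \sum_(k < t.+1) b k * (a k - a k.+1) <= b t * M.
Proof.
move=> b_ndecr a_bound.
suff telescope : \sum_(k < t.+1) b k * (a k - a k.+1) <= b t * (M - a t.+1).
  apply: le_trans telescope _; have /andP[b0 _] := b_ndecr t.
  by rewrite ler_wpM2l // gerBl; case/andP: (a_bound t.+1).
elim: t => [|t IH]; rewrite big_ord_recr /=.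
  by rewrite big_ord0 add0r ler_wpM2l ?(andP (b_ndecr 0)).1 // lerB // (andP (a_bound 0)).2.
apply: le_trans (lerD IH (lexx _)) _.
have /andP[b0 b1] := b_ndecr t; have /andP[a0 aM] := a_bound t.+1; nra.
Qed.

Lemma sum_invsqrt_le {R : rcfType} (t : nat) :
  \sum_(k < t) (Num.sqrt k.+1%:R)^-1 <= 2 * Num.sqrt t%:R :> R.
Proof.
elim: t => [|t IH]; first by rewrite big_ord0 sqrtr0 mulr0.
rewrite big_ord_recr /=; apply: le_trans (lerD IH (lexx _)) _.
have sqrt_gt0 : 0 < Num.sqrt t.+1%:R :> R by rewrite sqrtr_gt0 ltr0n.
have sqrtK : Num.sqrt t.+1%:R ^+ 2 = Num.sqrt t%:R ^+ 2 + 1 :> R.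
  by rewrite !sqr_sqrtr // natr1.
have sqrt_ge0 : 0 <= Num.sqrt t%:R :> R by rewrite sqrtr_ge0.
rewrite -(ler_pM2r sqrt_gt0) mulrDl mulVf ?gt_eqF //.
move: sqrt_gt0 sqrtK sqrt_ge0; move: (Num.sqrt _) (Num.sqrt _) => a b *; nra.
Qed.

(** * Rayleigh quotients *)

Lemma continuous_trmx {R : realType} {m n : nat} :
  continuous (@trmx R m n).
Proof.
move=> A B /nbhs_ballP[e e0 ballB]; apply/nbhs_ballP; exists e => // C [_ ballC].
by apply: ballB; split=> // i j; rewrite !mxE; exact: ballC.
Qed.

Lemma continuous_dotv {R : realType} {n : nat} {T : topologicalType}
    (f g : T -> 'cV[R]_n) :
  (forall i, continuous (fun x => f x i 0)) ->
  (forall i, continuous (fun x => g x i 0)) ->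
  continuous (fun x => dotv (f x) (g x)).
Proof.
move=> cf cg; apply: continuous_big => [|i _]; first exact: add_continuous.
by move=> x; apply: cvgM; [exact: cf|exact: cg].
Qed.

Lemma continuous_quadratic_form {R : realType} {n : nat} (M : 'M[R]_n) :
  continuous (fun u : 'cV[R]_n => dotv u (M *m u)).
Proof.
apply: continuous_dotv => i; first exact: coord_continuous.
under eq_fun do rewrite mxE.
apply: continuous_big => [|j _]; first exact: add_continuous.
by move=> u; apply: continuousM; [exact: cst_continuous|exact: coord_continuous].
Qed.

Lemma continuous_enorm {R : realType} {n : nat} : continuous (@enorm R n).
Proof.
move=> u; apply: continuous_comp; last exact: sqrt_continuous.
by apply: continuous_dotv => i; exact: coord_continuous.
Qed.

Lemma continuous_enorm_dist {R : realType} {n : nat} (c : 'cV[R]_n) :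
  continuous (fun z : 'cV[R]_n => enorm (c - z)).
Proof.
move=> z; have dist_c : {for z, continuous (fun z : 'cV[R]_n => c - z)}.
  by apply: continuousB; first exact: cst_continuous.
by apply: (continuous_comp dist_c); exact: continuous_enorm.
Qed.

Lemma compact_unit_sphere {R : realType} {n : nat} :
  compact [set u : 'cV[R]_n | enorm u = 1].
Proof.
pose box := [set u : 'rV[R]_n | forall i, `[(-1 : R), 1] (u 0 i)].
apply: (@subclosed_compact _ _ (trmx @` box)).
- apply: (@preimage_closed _ _ (@enorm R n) [set x | x = 1]); last exact: closed_eq.
  by move=> u _; exact: continuous_enorm.
- apply: continuous_compact.
    exact/continuous_subspaceT/continuous_trmx.
  by apply: (rV_compact (A := fun=> `[(-1 : R), 1])) => i; exact: segment_compact.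
- move=> u /= u1; exists u^T; last by rewrite trmxK.
  by move=> i; rewrite /= in_itv /= -ler_norml mxE -u1 norm_coord_le_enorm.
Qed.

Lemma rayleigh_max_exists {R : realType} {n : nat} (M : 'M[R]_n) (v : 'cV[R]_n) :
  v != 0 ->
  exists2 c, c != 0 &
    exists2 m, dotv c (M *m c) = m * dotv c c &
      forall w, dotv w (M *m w) <= m * dotv w w.
Proof.
have enorm_normalize (w : 'cV[R]_n) : w != 0 -> enorm ((enorm w)^-1 *: w) = 1.
  by rewrite -enorm_gt0 => w0; rewrite enormZ ?invr_ge0 ?ltW // mulVf ?gt_eqF.
move=> v0; have [] := @compact_EVT_max _ R _ _ _ (@compact_unit_sphere R n)
  (continuous_subspaceT (@continuous_quadratic_form _ _ M)).
  by exists ((enorm v)^-1 *: v); exact: enorm_normalize.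
move=> c; rewrite inE /= => c1 c_max; exists c.
  by rewrite -enorm_gt0 c1 ltr01.
exists (dotv c (M *m c)) => [|w]; first by rewrite -(enorm_sqr c) c1 expr1n mulr1.
have [->|w0] := eqVneq w 0; first by rewrite !dotv0l mulr0.
have := c_max ((enorm w)^-1 *: w); rewrite inE /= enorm_normalize // => /(_ erefl).
rewrite -scalemxAr dotvZl dotvZr mulrA -invfM -expr2 enorm_sqr mulrC.
by rewrite ler_pdivrMr // dotv_gt0.
Qed.

Lemma psd_form_eq0 {R : realType} {n : nat} (N : 'M[R]_n) (c : 'cV[R]_n) :
  N^T = N -> (forall w, 0 <= dotv w (N *m w)) -> dotv c (N *m c) = 0 ->
  N *m c = 0.
Proof.
move=> symN psdN c_null; apply/eqP; rewrite -dotv_eq0 eq_le dotv_ge0 andbT.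
rewrite -(pmulr_rle0 _ (ltr0n _ 2)).
apply: (@le0_of_le_small_multiples _ _ (dotv (N *m c) (N *m (N *m c)))) => th.
case/andP=> th0 _; rewrite -(ler_pM2l th0).
have := psdN (c - th *: (N *m c)); rewrite mulmxBr -scalemxAr !dotvE c_null.
rewrite -[dotv c (N *m (N *m c))]dotv_trmx symN; lra.
Qed.

Lemma rayleigh_le {R : realType} {n : nat} (M : 'M[R]_n) (lam : R) (v : 'cV[R]_n) :
  M^T = M -> is_lambda_max M lam -> dotv v (M *m v) <= lam * dotv v v.
Proof.
move=> symM [_ lam_max]; have [->|v0] := eqVneq v 0; first by rewrite !dotv0l mulr0.
have [c c0 [m cE m_max]] := rayleigh_max_exists M v0.
apply: le_trans (m_max v) _; rewrite ler_wpM2r ?dotv_ge0 // lam_max //.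
have formE w : dotv w ((m%:M - M) *m w) = m * dotv w w - dotv w (M *m w).
  by rewrite mulmxBl mul_scalar_mx !dotvE.
have : (m%:M - M) *m c = 0.
  apply: psd_form_eq0 => [|w|]; first by rewrite linearB /= tr_scalar_mx symM.
    by rewrite formE subr_ge0.
  by rewrite formE cE subrr.
rewrite mulmxBl mul_scalar_mx => /subr0_eq eigen_c.
apply/eigenvalueP; exists c^T; first by rewrite -[in RHS]linearZ /= eigen_c trmx_mul symM.
by apply: contra c0 => /eqP/(congr1 trmx); rewrite trmxK trmx0 => ->.
Qed.

Lemma gram_form_le {R : realType} {l d : nat} (F : 'M[R]_(l, d)) (lam : R)
    (v : 'cV[R]_d) :
  is_lambda_max (F^T *m F) lam -> dotv (F *m v) (F *m v) <= lam * dotv v v.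
Proof.
move=> /(rayleigh_le v); rewrite trmx_mul trmxK => /(_ erefl).
by rewrite -mulmxA dotvC dotv_trmx.
Qed.

Lemma gram_lambda_max_ge0 {R : realType} {l d : nat} (F : 'M[R]_(l, d)) (lam : R) :
  is_lambda_max (F^T *m F) lam -> 0 <= lam.
Proof.
move=> lamF; have [/eigenvalueP[v _ v0] _] := lamF.
have /pmulr_lge0 <- : 0 < dotv v^T v^T.
  by rewrite dotv_gt0; apply: contra v0 => /eqP/(congr1 trmx); rewrite trmxK trmx0 => ->.
exact: le_trans (dotv_ge0 _) (gram_form_le v^T lamF).
Qed.

Lemma dotv_mulmx_le_young {R : realType} {l d : nat} (F : 'M[R]_(l, d)) (lam r : R)
    (e : 'cV[R]_l) (h : 'cV[R]_d) :
  is_lambda_max (F^T *m F) lam -> 0 < r ->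
  dotv e (F *m h) <= lam * enorm e ^+ 2 / r + r / 4 * enorm h ^+ 2.
Proof.
move=> lamF r0; have lam0 := gram_lambda_max_ge0 lamF.
have Fh_le : enorm (F *m h) <= Num.sqrt lam * enorm h.
  by rewrite -sqrtrM // ler_wsqrtr // gram_form_le.
apply: le_trans (dotv_le_enormM _ _) _.
apply: le_trans (ler_wpM2l (enorm_ge0 e) Fh_le) _; rewrite mulrCA mulrA.
by apply: le_trans (mulr_le_young _ _ r0) _; rewrite exprMn sqr_sqrtr.
Qed.

Lemma dotv_le_young {R : realType} {n : nat} (u v : 'cV[R]_n) (r : R) :
  0 < r -> dotv u v <= enorm u ^+ 2 / r + r / 4 * enorm v ^+ 2.
Proof.
by move=> r0; apply: le_trans (dotv_le_enormM u v) _; exact: mulr_le_young.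
Qed.

(** * Smooth convex functions *)

Definition has_gradient_on {R : realType} {n : nat} (X : set 'cV[R]_n)
    (f : 'cV[R]_n -> R) (gradf : 'cV[R]_n -> 'cV[R]_n) : Prop :=
  forall x, X x -> differentiable f x /\ forall v, 'd f x v = dotv (gradf x) v.

Definition enorm_lipschitz_on {R : realType} {m n : nat} (X : set 'cV[R]_m) (L : R)
    (f : 'cV[R]_m -> 'cV[R]_n) : Prop :=
  forall x1 x2, X x1 -> X x2 -> enorm (f x1 - f x2) <= L * enorm (x1 - x2).

Section SmoothConvex.
Context {R : realType} {n : nat} (X : set 'cV[R]_n).
Variables (f : 'cV[R]_n -> R) (gradf : 'cV[R]_n -> 'cV[R]_n).
Hypotheses (convexX : convex_set_ X) (gradfP : has_gradient_on X f gradf).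

Lemma segmentE (x z : 'cV[R]_n) (t : R) :
  x + t *: (z - x) = t *: z + (1 - t) *: x.
Proof. by apply/matrixP => i j; rewrite !mxE; ring. Qed.

Lemma convex_set_segment (x z : 'cV[R]_n) (t : R) :
  X x -> X z -> 0 <= t <= 1 -> X (x + t *: (z - x)).
Proof. by move=> Xx Xz t01; rewrite segmentE; exact: convexX. Qed.

Lemma is_derive_along_segment (x h : 'cV[R]_n) (t : R) : X (x + t *: h) ->
  is_derive t 1 (fun u => f (x + u *: h)) (dotv (gradf (x + t *: h)) h).
Proof.
move=> /gradfP[df gradE].
have quotientE : (fun k : R => k^-1 *: (((fun u => f (x + u *: h)) \o shift t) (k *: 1)
      - f (x + t *: h))) =
    (fun k : R => k^-1 *: ((f \o shift (x + t *: h)) (k *: h) - f (x + t *: h))).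
  apply/funext => k /=; congr (_ *: (f _ - _)).
  by rewrite scaler1 scalerDl addrCA.
have df_h : derivable f (x + t *: h) h by exact: diff_derivable.
split; first by rewrite /derivable quotientE.
by rewrite /derive quotientE -/(derive f _ h) deriveE // gradE.
Qed.

Lemma convex_on_tangent_le (x z : 'cV[R]_n) :
  convex_on X f -> X x -> X z -> f x + dotv (gradf x) (z - x) <= f z.
Proof.
move=> convexf Xx Xz; have [df gradE] := gradfP Xx; rewrite -lerBrDl.
have slope_cvg : t^-1 *: (f (t *: (z - x) + x) - f x) @[t --> 0^'+]
    --> dotv (gradf x) (z - x).
  by rewrite -gradE -deriveE //; apply/cvg_dnbhs_at_right/diff_derivable.
apply: (cvgr_to_le slope_cvg); near=> t.
have t0 : 0 < t by [].
have t1 : t <= 1 by near: t; exact: nbhs_right_le.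
rewrite /GRing.scale /= ler_pdivrMl // [_ + x]addrC segmentE.
have t01 : 0 <= t <= 1 by rewrite ltW.
by have := convexf _ _ Xz Xx _ t01; lra.
Unshelve. all: by end_near. Qed.

Variable L : R.
Hypothesis lipschitz_gradf : enorm_lipschitz_on X L gradf.

Lemma lipschitz_gradient_segment_le (x z : 'cV[R]_n) (t : R) :
  X x -> X z -> 0 <= t <= 1 ->
  dotv (gradf (x + t *: (z - x))) (z - x) - dotv (gradf x) (z - x)
    <= t * (L * enorm (z - x) ^+ 2).
Proof.
move=> Xx Xz t01; have t0 : 0 <= t by case/andP: t01.
rewrite -dotvNl -dotvDl; apply: le_trans (dotv_le_enormM _ _) _.
have -> : t * (L * enorm (z - x) ^+ 2) = L * (t * enorm (z - x)) * enorm (z - x).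
  by ring.
rewrite -(enormZ _ t0) ler_wpM2r ?enorm_ge0 //.
have := lipschitz_gradf (convex_set_segment Xx Xz t01) Xx.
by rewrite [x + _ - x]addrC addKr.
Qed.

Lemma descent_lemma (x z : 'cV[R]_n) : X x -> X z ->
  f z <= f x + dotv (gradf x) (z - x) + L / 2 * enorm (z - x) ^+ 2.
Proof.
move=> Xx Xz; set a := dotv (gradf x) (z - x); set b := L / 2 * _.
pose p : {poly R} := a *: 'X + b *: 'X^2.
pose psi (u : R) := f (x + u *: (z - x)) - p.[u].
have psi' (u : R) : 0 <= u <= 1 -> is_derive u 1 psi
    (dotv (gradf (x + u *: (z - x))) (z - x) - (a + u * (2 * b))).
  move=> u01; have := is_derive_along_segment (convex_set_segment Xx Xz u01).
  have := is_derive_poly p u => ? ?; apply: is_derive_eq.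
  rewrite /p derivD !derivZ derivX derivXn /=.
  by rewrite !(hornerD, hornerZ, hornerC, hornerX, hornerMn); ring.
have in01 (u : R) : u \in `]0, 1[%R -> 0 <= u <= 1.
  by rewrite in_itv /= => /andP[u0 u1]; rewrite !ltW.
have psi10 : psi 1 <= psi 0.
  apply: (@ler0_derive1_le_cc _ psi 0 1) => [u /in01/psi'[]//|u /in01 u01||||//].
  - rewrite derive1E (@derive_val _ _ _ _ _ _ _ (psi' u u01)).
    have := lipschitz_gradient_segment_le Xx Xz u01; rewrite /b -/a; lra.
  - by apply: derivable_within_continuous => u; rewrite in_itv /= => /psi'[].
  - by rewrite in_itv /= lexx ler01.
  - by rewrite in_itv /= lexx ler01.
move: psi10; rewrite /psi scale1r scale0r addr0 [x + _]addrC subrK /p.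
by rewrite !(hornerD, hornerZ, hornerX, hornerXn) /b; lra.
Qed.

End SmoothConvex.

Definition saddle_gap {R : realType} {d l : nat} (loss : 'cV[R]_d -> R)
    (F : 'M[R]_(l, d)) (ys : 'cV[R]_l) (xs : 'cV[R]_d) (y : 'cV[R]_l) (x : 'cV[R]_d) : R :=
  Psad loss F ys x - Psad loss F y xs.

Section SaddleGap.
Context {R : realType} {d l : nat}.
Variables (X : set 'cV[R]_d) (Y : set 'cV[R]_l) (F : 'M[R]_(l, d)) (loss : 'cV[R]_d -> R).

(* By completing the square in [z]. *)
Lemma prox_ascent_is_projection (s : R) (x : 'cV[R]_d) (y y' : 'cV[R]_l) :
  0 < s -> Y y' ->
  (forall z, Y z -> Psad loss F z x - (2 * s)^-1 * enorm (z - y) ^+ 2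
    <= Psad loss F y' x - (2 * s)^-1 * enorm (y' - y) ^+ 2) ->
  is_projection Y (y + s *: (F *m x)) y'.
Proof.
move=> s0 Yy' prox; split=> // z /prox; rewrite /Psad ler_enorm !enorm_sqr.
have s2 : 0 < 2 * s by rewrite mulr_gt0.
move: (F *m x) => f; rewrite -(ler_pM2l s2) !mulrBr !(mulVKf (lt0r_neq0 s2)).
rewrite !dotvE (dotvC y z) (dotvC y y') (dotvC f z) (dotvC f y') (dotvC f y); lra.
Qed.

Lemma saddle_gap_avg_le (xk : nat -> 'cV[R]_d) (yk : nat -> 'cV[R]_l)
    (ys : 'cV[R]_l) (xs : 'cV[R]_d) (t : nat) :
  convex_set_ X -> convex_on X loss -> (forall k, X (xk k.+1)) ->
  saddle_gap loss F ys xs (avg yk t) (avg xk t) <=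
    t.+1%:R^-1 * \sum_(k < t.+1) saddle_gap loss F ys xs (yk k.+1) (xk k.+1).
Proof.
move=> cX cf Xk; rewrite /saddle_gap sumrB mulrBr /Psad !big_split /= !mulrDr.
rewrite mulmx_avg dotvC !dotv_avgl sumr_const card_ord -[loss xs *+ _]mulr_natl.
rewrite mulKf ?pnatr_eq0 // lerB // lerD //; first exact: convex_on_avg cf _.
by under eq_bigr do rewrite dotvC.
Qed.

End SaddleGap.

(** * Measurable vector-valued maps *)

Section MeasurableVec.
Context {R : realType} {dT : measure_display} {T : measurableType dT}.

Lemma measurable_vec_cst (n : nat) (c : 'cV[R]_n) : measurable_vec (fun _ : T => c).
Proof. by move=> i; exact: measurable_cst. Qed.

Lemma measurable_vecD (n : nat) (U V : T -> 'cV[R]_n) :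
  measurable_vec U -> measurable_vec V -> measurable_vec (fun w => U w + V w).
Proof. by move=> mU mV i; under eq_fun do rewrite mxE; exact: measurable_funD. Qed.

Lemma measurable_vecB (n : nat) (U V : T -> 'cV[R]_n) :
  measurable_vec U -> measurable_vec V -> measurable_vec (fun w => U w - V w).
Proof. by move=> mU mV i; under eq_fun do rewrite !mxE; exact: measurable_funB. Qed.

Lemma measurable_vec_mulmx (m n : nat) (A : 'M[R]_(m, n)) (U : T -> 'cV[R]_n) :
  measurable_vec U -> measurable_vec (fun w => A *m U w).
Proof.
move=> mU i; under eq_fun do rewrite mxE.
by apply: measurable_sum => j; exact: measurable_funM.
Qed.

Lemma measurable_vecZ (n : nat) (c : R) (U : T -> 'cV[R]_n) :
  measurable_vec U -> measurable_vec (fun w => c *: U w).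
Proof.
by move=> mU; under eq_fun do rewrite -mul_scalar_mx; exact: measurable_vec_mulmx.
Qed.

Lemma measurable_vec_avg (n : nat) (U : nat -> T -> 'cV[R]_n) (t : nat) :
  (forall k, measurable_vec (U k)) -> measurable_vec (fun w => avg (U^~ w) t).
Proof.
move=> mU; apply: measurable_vecZ => i; under eq_fun do rewrite summxE.
by apply: measurable_sum => j; exact: mU.
Qed.

Lemma measurable_dotv (n : nat) (U V : T -> 'cV[R]_n) :
  measurable_vec U -> measurable_vec V -> measurable_fun setT (fun w => dotv (U w) (V w)).
Proof. by move=> mU mV; apply: measurable_sum => i; exact: measurable_funM. Qed.

Lemma measurable_enorm_sqr (n : nat) (U : T -> 'cV[R]_n) :
  measurable_vec U -> measurable_fun setT (fun w => enorm (U w) ^+ 2).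
Proof. by move=> mU; under eq_fun do rewrite enorm_sqr; exact: measurable_dotv. Qed.

End MeasurableVec.

Lemma rat_vec_dense {R : realType} {n : nat} (c : 'cV[R]_n) (e : R) :
  0 < e -> exists q : 'cV[rat]_n, ball c e (map_mx ratr q).
Proof.
move=> e0; have /choice[q near_q] (i : 'I_n) : exists q : rat, ball (c i 0) e (ratr q : R).
  have [|q] := @rat_in_itvoo R (c i 0) (c i 0 + e); first by rewrite ltrDl.
  rewrite in_itv /= => /andP[cq qc]; exists q.
  by rewrite /ball /= distrC ger0_norm ?subr_ge0 ?(ltW cq) // ltrBlDl.
by exists (\col_i q i); split=> // i j; rewrite !mxE ord1; exact: near_q.
Qed.

Section MeasurableContinuous.
Context {R : realType} {dT : measure_display} {T : measurableType dT} {n : nat}.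
Variable Z : T -> 'cV[R]_n.
Hypothesis measurable_Z : measurable_vec Z.

Lemma measurable_vec_ball (c : 'cV[R]_n) (e : R) : 0 < e -> measurable (Z @^-1` ball c e).
Proof.
move=> e0; have -> : Z @^-1` ball c e =
    \bigcap_(i : 'I_n) (fun w => Z w i 0) @^-1` ball (c i 0) e.
  apply/seteqP; split=> w /= => [[_ ballZ] i _|ballZ]; first exact: ballZ.
  by split=> // i j; rewrite ord1; exact: ballZ.
apply: fin_bigcap_measurable => // i _; rewrite -[X in measurable X]setTI.
by apply: measurable_Z => //; exact: measurable_ball.
Qed.

Lemma measurable_vec_open (U : set 'cV[R]_n) : open U -> measurable (Z @^-1` U).
Proof.
move=> openU.
pose B (p : 'cV[rat]_n * nat) : set 'cV[R]_n := ball (map_mx ratr p.1 : 'cV[R]_n) p.2.+1%:R^-1.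
have -> : Z @^-1` U = \bigcup_(p in [set p | B p `<=` U]) Z @^-1` B p.
  apply/seteqP; split=> [w Uw|w [p BU Bw]]; last exact: BU.
  have /nbhs_ballP[e /= e0 ballU] := open_nbhs_nbhs (conj openU Uw).
  have [k _ /(_ _ (leqnn k)) /= ke] :=
    near_infty_natSinv_lt (PosNum (divr_gt0 e0 (ltr0n R 2))).
  have [|q near_q] := rat_vec_dense (Z w) (e := k.+1%:R^-1); first by rewrite invr_gt0.
  exists (q, k); last exact: ball_sym.
  move=> z Bz; apply: ballU.
  exact: ball_split (le_ball (ltW ke) near_q) (le_ball (ltW ke) Bz).
rewrite bigcup_mkcond; apply: countable_bigcupT_measurable => // p.
by case: ifP => // _; apply: measurable_vec_ball; rewrite invr_gt0.
Qed.

(* The hypothesis is continuity of [h] for the topology induced by [Z], which makes sense even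
   when [h] is not given as a function of [Z]. *)
Lemma measurable_fun_of_near (h : T -> R) :
  (forall w e, 0 < e ->
    \forall z \near Z w, forall w', Z w' = z -> `|h w - h w'| < e) ->
  measurable_fun setT h.
Proof.
move=> near_h; apply: (measurability _ (RGenOInfty.measurableE R)) => _ [_ [a ->] <-].
have -> : setT `&` h @^-1` `]a, +oo[ =
    Z @^-1` ([set z | forall w', Z w' = z -> a < h w']^°).
  apply/seteqP; split=> w /=; last first.
    by move=> /interior_subset/(_ w erefl) aw; rewrite in_itv /= andbT.
  rewrite in_itv /= andbT => -[_ aw]; rewrite -subr_gt0 in aw.
  apply: filterS (near_h w _ aw) => z close_h w' /close_h.
  by rewrite ltr_norml => /andP[_]; lra.
exact/measurable_vec_open/open_interior.
Qed.

Lemma measurable_comp_continuous (f : 'cV[R]_n -> R) :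
  (forall w, {for Z w, continuous f}) -> measurable_fun setT (fun w => f (Z w)).
Proof.
move=> cf; apply: measurable_fun_of_near => w e e0.
have /cvgrPdist_lt/(_ e e0) := cf w.
by apply: filterS => z near_f w' ->.
Qed.

Lemma measurable_vec_of_lipschitz {m : nat} (W : T -> 'cV[R]_m) (K : R) :
  (forall w w', enorm (W w - W w') <= K * enorm (Z w - Z w')) -> measurable_vec W.
Proof.
move=> lipW i; apply: measurable_fun_of_near => w e e0.
have modulus_continuous : continuous (fun z : 'cV[R]_n => K * enorm (Z w - z)).
  move=> z; exact: (continuousM (@cst_continuous _ _ K z) (@continuous_enorm_dist _ _ (Z w) z)).
have : \forall z \near Z w, K * enorm (Z w - z) < e.
  by apply: (cvgr_lt _ (modulus_continuous (Z w))); rewrite subrr /enorm dotv0l sqrtr0 mulr0.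
apply: filterS => z modulus_lt w' Zw'; apply: le_lt_trans modulus_lt; rewrite -Zw'.
apply: le_trans (lipW w w').
by have := norm_coord_le_enorm (W w - W w') i; rewrite !mxE.
Qed.

End MeasurableContinuous.

(** * Expectations and independent pairs *)

Definition mean_le {R : realType} {dT : measure_display} {T : measurableType dT}
    (P : probability T R) (f : T -> R) (c : R) : Prop :=
  f \in Lfun P 1 /\ ('E_P[f] <= c%:E)%E.

Section MeanLe.
Context {R : realType} {dT : measure_display} {T : measurableType dT}.
Variable P : probability T R.
Implicit Types (f g : T -> R) (a b c : R).

Lemma mean_le_cst c : mean_le P (fun=> c) c.
Proof. by split; [exact: Lfun_cst|rewrite expectation_cst]. Qed.

Lemma mean_leD f g a b :
  mean_le P f a -> mean_le P g b -> mean_le P (fun w => f w + g w) (a + b).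
Proof.
move=> [Lf fa] [Lg gb]; split; first exact: rpredD.
by rewrite expectationD // EFinD leeD.
Qed.

Lemma mean_leMr f a c : 0 <= c -> mean_le P f a -> mean_le P (fun w => f w * c) (a * c).
Proof.
move=> c0 [Lf fa]; split; first exact: Lfun_scale.
by rewrite expectationZl // EFinM muleC lee_wpmul2r // lee_fin.
Qed.

Lemma mean_le_sum (I : Type) (r : seq I) (f : I -> T -> R) (a : I -> R) :
  (forall i, mean_le P (f i) (a i)) ->
  mean_le P (fun w => \sum_(i <- r) f i w) (\sum_(i <- r) a i).
Proof.
move=> fa; elim: r => [|i r IH].
  by under eq_fun do rewrite big_nil; rewrite big_nil; exact: mean_le_cst.
by under eq_fun do rewrite big_cons; rewrite big_cons; exact: mean_leD.
Qed.

Lemma ge0_mean_le f c :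
  measurable_fun setT f -> (forall w, 0 <= f w) -> ('E_P[f] <= c%:E)%E -> mean_le P f c.
Proof.
move=> mf f0 fc; split=> //; apply/Lfun1_integrable/integrableP.
split; first exact/measurable_EFinP.
under eq_integral do rewrite gee0_abs ?lee_fin //.
by move: fc; rewrite unlock => /le_lt_trans; apply; exact: ltry.
Qed.

Lemma expectation_le_mean_le f g c :
  measurable_fun setT f -> (forall w, 0 <= f w <= g w) -> mean_le P g c ->
  ('E_P[f] <= c%:E)%E.
Proof.
move=> mf fg [/Lfun1_integrable/measurable_int/measurable_EFinP mg]; apply: le_trans.
apply: expectation_le => //.
- by move=> w; case/andP: (fg w).
- by move=> w; case/andP: (fg w) => /le_trans h /h.
- by apply: aeW => w; case/andP: (fg w).
Qed.

End MeanLe.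

Lemma expectation_dotv {R : realType} {dT : measure_display} {T : measurableType dT}
    (P : probability T R) (n : nat) (U : T -> 'cV[R]_n) (m v : 'cV[R]_n) :
  (forall i, (fun w => U w i 0) \in Lfun P 1 /\ ('E_P[fun w => U w i ord0] = (m i ord0)%:E)%E) ->
  ('E_P[fun w => dotv (U w) v] = (dotv m v)%:E)%E.
Proof.
move=> meanU; rewrite unlock; under eq_integral do rewrite -sumEFin.
rewrite integral_sum // => [|i]; last first.
  by apply/Lfun1_integrable/Lfun_scale => //; case: (meanU i).
rewrite -sumEFin; apply: eq_bigr => i _; have [LU EU] := meanU i.
have := expectationZl (v i 0) LU; rewrite unlock /= => ->.
by move: EU; rewrite unlock => ->; rewrite -EFinM mulrC.
Qed.

Definition independent_with_law {R : realType} {dT dU dZ : measure_display}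
    {T : measurableType dT} {U : measurableType dU} {Z : measurableType dZ}
    (P : probability T R) (mu : probability Z R) (X : T -> U) (Y : T -> Z) : Prop :=
  forall A B, measurable A -> measurable B ->
    P (X @^-1` A `&` Y @^-1` B) = (P (X @^-1` A) * mu B)%E.

Section IndependentPair.
Context {R : realType} {dT dU dZ : measure_display}.
Context {T : measurableType dT} {U : measurableType dU} {Z : measurableType dZ}.
Variables (P : probability T R) (mu : probability Z R).
Variables (X : {mfun T >-> U}) (Y : {mfun T >-> Z}).
Hypothesis indepXY : independent_with_law P mu X Y.

Let measurable_pair : measurable_fun setT (fun w => (X w, Y w)).
Proof. exact: measurable_fun_pair. Qed.

Let XY : {mfun T >-> (U * Z)%type} := mfun_Sub (mem_set measurable_pair).

Lemma integral_distribution_pair (f : U * Z -> \bar R) :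
  (\int[distribution P XY]_p f p = \int[distribution P X \x mu]_p f p)%E.
Proof.
apply: eq_measure_integral => A mA _; apply/esym.
by apply: product_measure_unique mA => B C mB mC; exact: indepXY.
Qed.

Lemma ge0_integral_independent_pair (f : U * Z -> \bar R) :
  measurable_fun setT f -> (forall p, 0 <= f p)%E ->
  (\int[P]_w f (X w, Y w) = \int[distribution P X]_u \int[mu]_z f (u, z))%E.
Proof.
move=> mf f0; rewrite -[RHS]fubini_tonelli1 // -integral_distribution_pair.
by rewrite ge0_integral_distribution.
Qed.

Lemma integral_independent_pair (f : U * Z -> \bar R) :
  measurable_fun setT f -> P.-integrable setT (fun w => f (X w, Y w)) ->
  (\int[P]_w f (X w, Y w) = \int[distribution P X]_u \int[mu]_z f (u, z))%E.
Proof.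
move=> mf intf; rewrite integral12_prod_meas1 -?integral_distribution_pair.
  by rewrite integral_distribution.
apply/integrableP; split=> //; rewrite -integral_distribution_pair.
by have /integrableP[] := integrable_pushforward measurable_pair mf intf measurableT.
Qed.

Variables (n : nat) (D : U * Z -> 'cV[R]_n).
Hypothesis measurable_D : measurable_vec D.

Lemma mean_le_enorm_sqr_independent_pair (c : R) :
  (forall u, 'E_mu[fun z => (enorm (D (u, z)) ^+ 2)%R] <= c%:E)%E ->
  mean_le P (fun w => enorm (D (X w, Y w)) ^+ 2) c.
Proof.
move=> Dc; have mD := measurable_enorm_sqr measurable_D.
apply: ge0_mean_le => [|w|]; [exact: measurableT_comp mD measurable_pair|exact: sqr_ge0|].
pose Dsq p := (enorm (D p) ^+ 2)%:E.
have mDsq : measurable_fun setT Dsq by exact/measurable_EFinP.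
have Dsq_ge0 p : (0 <= Dsq p)%E by rewrite lee_fin sqr_ge0.
rewrite unlock (ge0_integral_independent_pair mDsq Dsq_ge0).
apply: (@le_trans _ _ (\int[distribution P X]_u c%:E)%E); last first.
  by rewrite integral_cst //= probability_setT mule1.
apply: ge0_le_integral => //.
- by move=> u _; exact: integral_ge0.
- exact: measurable_fun_fubini_tonelli_F.
- by move=> u _; move: (Dc u); rewrite unlock.
Qed.

Lemma mean_le_dotv_independent_pair (c B : R) (V : U -> 'cV[R]_n) :
  (forall u i, (fun z => D (u, z) i 0) \in Lfun mu 1 /\
     ('E_mu[fun z => D (u, z) i ord0] = 0)%E) ->
  mean_le P (fun w => enorm (D (X w, Y w)) ^+ 2) c ->
  measurable_vec V -> (forall u, enorm (V u) <= B) ->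
  mean_le P (fun w => dotv (D (X w, Y w)) (V (X w))) 0.
Proof.
move=> meanD [LD _] mV VB.
have mdot : measurable_fun setT (fun p : U * Z => dotv (D p) (V p.1)).
  by apply: measurable_dotv => // i; exact: measurableT_comp (mV i) measurable_fst.
have int_dot : P.-integrable setT (fun w => (dotv (D (X w, Y w)) (V (X w)))%:E).
  have /Lfun1_integrable : (fun w => enorm (D (X w, Y w)) ^+ 2 + B ^+ 2) \in Lfun P 1.
    by apply: rpredD => //; exact: Lfun_cst.
  apply: le_integrable => //.
    exact/measurable_EFinP/(measurableT_comp mdot measurable_pair).
  move=> w _; rewrite /= lee_fin [leRHS]ger0_norm ?addr_ge0 ?sqr_ge0 //.
  apply: le_trans (norm_dotv_le _ _) _.
  apply: le_trans (ler_wpM2l (enorm_ge0 _) (VB (X w))) _.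
  by have := sqr_ge0 (enorm (D (X w, Y w)) - B); have := sqr_ge0 (enorm (D (X w, Y w)) + B); lra.
split; first exact/Lfun1_integrable.
rewrite unlock (@integral_independent_pair (fun p => (dotv (D p) (V p.1))%:E)) //; last first.
  exact/measurable_EFinP.
rewrite (eq_integral (cst 0%E)) ?integral0 // => u _.
suff : ('E_mu[fun z => dotv (D (u, z)) (V u)] = 0)%E by rewrite unlock.
by rewrite (expectation_dotv (m := 0)) ?dotv0l // => i; rewrite mxE.
Qed.

End IndependentPair.

(** * The past of an independent sequence *)

Definition past_cylinders {T Xi : Type} (mXi : set (set Xi)) (xi : nat -> T -> Xi)
    (k : nat) : set (set T) :=
  [set A | exists2 B : nat -> set Xi, (forall j, mXi (B j)) &
           A = \big[setI/setT]_(j <- iota 1 k) (xi j @^-1` B j)].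

Local Notation pastType xi k := (g_sigma_algebraType (past_cylinders measurable xi k)).

Section Past.
Context {R : realType} {dT dX : measure_display}.
Context {T : measurableType dT} {Xi : measurableType dX}.
Variables (P : probability T R) (mu : probability Xi R) (xi : nat -> T -> Xi) (k : nat).

Lemma setI_closed_past_cylinders : setI_closed (past_cylinders measurable xi k).
Proof.
move=> _ _ [B mB ->] [C mC ->]; exists (fun j => B j `&` C j).
  by move=> j; exact: measurableI.
by rewrite -big_split.
Qed.

Lemma past_cylindersT : past_cylinders measurable xi k setT.
Proof. by exists (fun=> setT) => //; rewrite big1. Qed.

Lemma measurable_sample_past (j : nat) :
  (0 < j <= k)%N -> measurable_fun setT (xi j : pastType xi k -> Xi).
Proof.
move=> jk _ C mC; rewrite setTI; apply: sub_sigma_algebra.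
exists (fun i => if i == j then C else setT); first by move=> i; case: eqP.
rewrite (bigD1_seq j) ?iota_uniq //=; last by rewrite mem_iota add1n ltnS.
by rewrite eqxx big1 ?setIT // => i /negbTE ->.
Qed.

Hypothesis indep_xi : mutually_independent P xi.

Lemma sub_past_cylinders_measurable : past_cylinders measurable xi k `<=` @measurable _ T.
Proof.
move=> _ [B mB ->]; apply: big_ind => // [A C|j _]; first exact: measurableI.
by rewrite -[X in measurable X]setTI; exact: indep_xi.1.
Qed.

Lemma measurable_to_past : measurable_fun setT (id : T -> pastType xi k).
Proof.
move=> _ A mA; rewrite setTI preimage_id.
exact: (smallest_sub (sigma_algebra_measurable T) sub_past_cylinders_measurable) mA.
Qed.

Hypothesis law_xi : identically_distributed P xi mu.

Lemma past_cylinder_next_independent (A : set T) (B : set Xi) :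
  past_cylinders measurable xi k A -> measurable B ->
  P (A `&` xi k.+1 @^-1` B) = (P A * mu B)%E.
Proof.
move=> [C mC ->] mB; pose C' j := if j == k.+1 then B else C j.
have C'E : \big[setI/setT]_(j <- iota 1 k) (xi j @^-1` C j) =
    \big[setI/setT]_(j <- iota 1 k) (xi j @^-1` C' j).
  apply: eq_big_seq => j; rewrite mem_iota add1n ltnS /C' => /andP[_ jk].
  by rewrite ltn_eqF.
have C'k : C' k.+1 = B by rewrite /C' eqxx.
have mC' j : measurable (C' j) by rewrite /C'; case: eqP.
have uniq_k : uniq (k.+1 :: iota 1 k).
  by rewrite /= mem_iota add1n ltnS ltnn andbF iota_uniq.
have := indep_xi.2 _ C' uniq_k mC'.
by rewrite !big_cons C'k -indep_xi.2 ?iota_uniq // -C'E law_xi // setIC muleC.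
Qed.

Lemma past_next_independent :
  independent_with_law P mu (id : T -> pastType xi k) (xi k.+1).
Proof.
move=> A B mA mB; rewrite preimage_id.
have mBk : measurable (xi k.+1 @^-1` B).
  by rewrite -[X in measurable X]setTI; exact: indep_xi.1.
have muBE : mu B = (fine (mu B))%:E by rewrite fineK // fin_num_measure.
rewrite muBE muleC.
apply: (@g_sigma_algebra_measure_unique _ R T _ sub_past_cylinders_measurable (fun=> setT)
  (fun=> past_cylindersT) _ (mrestr P mBk)
  (mscale (NngNum (fine_ge0 (measure_ge0 mu B))) P) setI_closed_past_cylinders) => //.
- by rewrite bigcup_const //; exists 0%N.
- move=> C cylC; change (P (C `&` xi k.+1 @^-1` B) = ((fine (mu B))%:E * P C)%E).
  by rewrite -muBE muleC past_cylinder_next_independent.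
- move=> _; change (P (setT `&` xi k.+1 @^-1` B) < +oo)%E; rewrite setTI.
  exact: le_lt_trans (probability_le1 P mBk) (ltry 1).
Qed.

End Past.

(** * Duality gap of SPDHG *)

Definition stochastic_gradient_on {R : realType} {d : nat} {dX : measure_display}
    {Xi : measurableType dX} (X : set 'cV[R]_d) (mu : probability Xi R)
    (G : 'cV[R]_d -> Xi -> 'cV[R]_d) (gradl : 'cV[R]_d -> 'cV[R]_d) (v : R) : Prop :=
  forall x, X x ->
    (forall i, mu.-integrable setT (fun z => (G x z i ord0)%:E) /\
               ('E_mu[fun z => G x z i ord0] = (gradl x i ord0)%:E)%E) /\
    ('E_mu[fun z => (enorm (G x z - gradl x) ^+ 2)%R] <= v%:E)%E.

Definition spdhg_step {R : realType} {d l : nat} (X : set 'cV[R]_d) (Y : set 'cV[R]_l)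
    (F : 'M[R]_(l, d)) (s b : R) (g x x' : 'cV[R]_d) (y y' : 'cV[R]_l) : Prop :=
  is_projection Y (y + s *: (F *m x)) y' /\
  is_projection X (x - b *: (g + F^T *m y')) x'.

Section Spdhg.
Context {R : realType} {d l : nat}.
Variables (X : set 'cV[R]_d) (Y : set 'cV[R]_l) (F : 'M[R]_(l, d)) (lam : R).
Variables (loss : 'cV[R]_d -> R) (gradl : 'cV[R]_d -> 'cV[R]_d) (L s : R).
Variables (ys : 'cV[R]_l) (xs : 'cV[R]_d).
Hypotheses (convexX : convex_set_ X) (convexY : convex_set_ Y).
Hypothesis lamF : is_lambda_max (F^T *m F) lam.
Hypotheses (convex_loss : convex_on X loss) (gradlP : has_gradient_on X loss gradl).
Hypotheses (L0 : 0 <= L) (lipschitz_gradl : enorm_lipschitz_on X L gradl).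
Hypotheses (s0 : 0 < s) (Yys : Y ys) (Xxs : X xs).

Lemma spdhg_step_gap_le (r : R) (g x x' : 'cV[R]_d) (y y' : 'cV[R]_l) :
  0 < r -> X x -> spdhg_step X Y F s (r + L)^-1 g x x' y y' ->
  saddle_gap loss F ys xs y' x' <=
    (r + L) / 2 * (enorm (x - xs) ^+ 2 - enorm (x' - xs) ^+ 2)
    + (2 * s)^-1 * (enorm (y - ys) ^+ 2 - enorm (y' - ys) ^+ 2)
    + ((enorm (g - gradl x) ^+ 2 + lam * enorm (y' - ys) ^+ 2) / r
       + dotv (g - gradl x) (xs - x)).
Proof.
move=> r0 Xx [projY projX]; set delta := g - gradl x.
have dual : dotv (ys - y') (F *m x) <=
    (2 * s)^-1 * (enorm (y - ys) ^+ 2 - enorm (y' - ys) ^+ 2).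
  have := @projected_step_le _ _ _ convexY y (- (F *m x)) y' ys s s0.
  rewrite scalerN opprK => /(_ projY Yys).
  rewrite dotvNl dotvC -dotvNl opprB => /le_trans; apply.
  by rewrite ler_wpM2l ?gerBl ?sqr_ge0 // invr_ge0 mulr_ge0 ?ltW.
have primal : dotv (g + F^T *m y') (x' - xs) <=
    (r + L) / 2 * (enorm (x - xs) ^+ 2 - enorm (x' - xs) ^+ 2 - enorm (x' - x) ^+ 2).
  rewrite -invf_div; apply: (projected_step_le convexX _ projX Xxs).
  by rewrite invr_gt0 ltr_pwDl.
have descent := descent_lemma convexX gradlP lipschitz_gradl Xx projX.1.
have tangent := convex_on_tangent_le gradlP convex_loss Xx Xxs.
have noise : - dotv delta (x' - x) <=
    enorm delta ^+ 2 / r + r / 4 * enorm (x' - x) ^+ 2.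
  by rewrite -dotvNl -(enormN delta); exact: dotv_le_young.
have lag : dotv (ys - y') (F *m (x' - x)) <=
    lam * enorm (y' - ys) ^+ 2 / r + r / 4 * enorm (x' - x) ^+ 2.
  by rewrite -(enormN (y' - ys)) opprB; exact: dotv_mulmx_le_young.
have gapE : saddle_gap loss F ys xs y' x' = loss x' - loss xs
    + dotv (ys - y') (F *m x) + dotv (ys - y') (F *m (x' - x))
    + dotv (F^T *m y') (x' - xs).
  by rewrite /saddle_gap /Psad dotv_trmx !mulmxBr !dotvE; ring.
have gradientE : dotv (gradl x) (x' - x) - dotv (gradl x) (xs - x) =
    dotv g (x' - xs) - dotv delta (x' - x) + dotv delta (xs - x).
  by rewrite /delta !dotvE; ring.
by move: primal; rewrite dotvDl gapE; lra.
Qed.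

Variables (Dx Dy : R) (r : nat -> R).
Hypotheses (diamX : diam_le X Dx) (diamY : diam_le Y Dy).
Hypotheses (r_gt0 : forall k, 0 < r k) (r_ndecr : forall k, r k <= r k.+1).

Lemma spdhg_gap_le (g xk : nat -> 'cV[R]_d) (yk : nat -> 'cV[R]_l) (t : nat) :
  X (xk 0%N) -> Y (yk 0%N) ->
  (forall k, spdhg_step X Y F s (r k + L)^-1 (g k) (xk k) (xk k.+1) (yk k) (yk k.+1)) ->
  saddle_gap loss F ys xs (avg yk t) (avg xk t) <=
    t.+1%:R^-1 * ((r t + L) / 2 * Dx ^+ 2 + (2 * s)^-1 * Dy ^+ 2
      + \sum_(k < t.+1) ((enorm (g k - gradl (xk k)) ^+ 2 + lam * Dy ^+ 2) / r k
                         + dotv (g k - gradl (xk k)) (xs - xk k))).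
Proof.
move=> Xx0 Yy0 step.
have Xk k : X (xk k) by case: k => // k; exact: (step k).2.1.
have Yk k : Y (yk k) by case: k => // k; exact: (step k).1.1.
apply: le_trans (saddle_gap_avg_le _ _ _ _ _ convexX convex_loss (fun k => Xk k.+1)) _.
rewrite ler_wpM2l ?invr_ge0 //.
apply: le_trans (ler_sum _ (fun (k : 'I_t.+1) _ =>
  spdhg_step_gap_le (r_gt0 k) (Xk k) (step k))) _.
rewrite !big_split /= -!addrA; apply: lerD; last apply: lerD; last first.
- rewrite -!big_split /=; apply: ler_sum => k _; rewrite lerD2r.
  rewrite ler_wpM2r ?invr_ge0 ?(ltW (r_gt0 k)) //.
  by rewrite lerD2l ler_wpM2l ?(gram_lambda_max_ge0 lamF) // (enorm_sqr_diam_le diamY).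
- apply: (telescope_weighted_le (a := fun k => enorm (yk k - ys) ^+ 2)
    (b := fun=> (2 * s)^-1)) => k.
    by rewrite lexx invr_ge0 mulr_ge0 // (ltW s0).
  by rewrite sqr_ge0 (enorm_sqr_diam_le diamY).
- apply: (telescope_weighted_le (a := fun k => enorm (xk k - xs) ^+ 2)
    (b := fun k => (r k + L) / 2)) => k.
    by have := r_gt0 k; have := r_ndecr k; move: L0; lra.
  by rewrite sqr_ge0 (enorm_sqr_diam_le diamX).
Qed.

Context {dX : measure_display} {Xi : measurableType dX} (mu : probability Xi R).
Variables (G : 'cV[R]_d -> Xi -> 'cV[R]_d) (v : R).
Hypotheses (measurable_G : jointly_measurable G).

Definition spdhg_run {T : Type} (xi : nat -> T -> Xi) (xk : nat -> T -> 'cV[R]_d)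
    (yk : nat -> T -> 'cV[R]_l) : Prop :=
  forall k w, spdhg_step X Y F s (r k + L)^-1 (G (xk k w) (xi k.+1 w))
    (xk k w) (xk k.+1 w) (yk k w) (yk k.+1 w).

Lemma measurable_spdhg_run {dT : measure_display} {T : measurableType dT}
    (xi : nat -> T -> Xi) xk yk (k : nat) :
  spdhg_run xi xk yk -> measurable_vec (xk 0%N) -> measurable_vec (yk 0%N) ->
  (forall j, (0 < j <= k)%N -> measurable_fun setT (xi j)) ->
  measurable_vec (xk k) /\ measurable_vec (yk k).
Proof.
move=> run mx0 my0; elim: k => // k IH mxi.
have [|mx my] := IH; first by move=> j /andP[j0 jk]; apply: mxi; rewrite j0 ltnW.
have my' : measurable_vec (yk k.+1).
  apply: (@measurable_vec_of_lipschitz _ _ _ _ (fun w => yk k w + s *: (F *m xk k w)) _ _ _ 1).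
    by apply: measurable_vecD => //; apply: measurable_vecZ; exact: measurable_vec_mulmx.
  by move=> w w'; rewrite mul1r; exact: projection_nonexpansive (run k w).1 (run k w').1.
split=> //.
apply: (@measurable_vec_of_lipschitz _ _ _ _ (fun w => xk k w - (r k + L)^-1 *:
    (G (xk k w) (xi k.+1 w) + F^T *m yk k.+1 w)) _ _ _ 1).
  apply: measurable_vecB => //; apply: measurable_vecZ; apply: measurable_vecD.
    by apply: measurable_G => //; apply: mxi; rewrite /= leqnn.
  exact: measurable_vec_mulmx.
by move=> w w'; rewrite mul1r; exact: projection_nonexpansive (run k w).2 (run k w').2.
Qed.

Hypothesis oracleP : stochastic_gradient_on X mu G gradl v.

Context {dT : measure_display} {T : measurableType dT} (P : probability T R).
Variables (xi : nat -> T -> Xi) (xk : nat -> T -> 'cV[R]_d) (yk : nat -> T -> 'cV[R]_l).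
Variables (x0 : 'cV[R]_d) (y0 : 'cV[R]_l).
Hypotheses (indep_xi : mutually_independent P xi) (law_xi : identically_distributed P xi mu).
Hypotheses (Xx0 : X x0) (Yy0 : Y y0) (xk0 : xk 0%N = fun=> x0) (yk0 : yk 0%N = fun=> y0).
Hypothesis run : spdhg_run xi xk yk.

Lemma spdhg_run_feasible k w : X (xk k w) /\ Y (yk k w).
Proof.
case: k => [|k]; first by rewrite xk0 yk0.
by have [[Yy _] [Xx _]] := run k w.
Qed.

Definition gradient_noise (k : nat) (w : T) : 'cV[R]_d :=
  G (xk k w) (xi k.+1 w) - gradl (xk k w).

Lemma measurable_vec_past_iterate (k : nat) : measurable_vec (xk k : pastType xi k -> _).
Proof.
have [] // := @measurable_spdhg_run _ (pastType xi k) xi xk yk k run.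
- by rewrite xk0; exact: measurable_vec_cst.
- by rewrite yk0; exact: measurable_vec_cst.
- by move=> j jk; exact: measurable_sample_past.
Qed.

Let past (k : nat) : {mfun T >-> pastType xi k} :=
  mfun_Sub (mem_set (measurable_to_past (k := k) indep_xi)).

Let next (k : nat) : {mfun T >-> Xi} := mfun_Sub (mem_set (indep_xi.1 k.+1)).

Let past_next_noise (k : nat) (p : pastType xi k * Xi) : 'cV[R]_d :=
  G (xk k p.1) p.2 - gradl (xk k p.1).

Let indep_past_next (k : nat) : independent_with_law P mu (past k) (next k).
Proof. exact: past_next_independent. Qed.

Lemma measurable_past_next_noise (k : nat) : measurable_vec (@past_next_noise k).
Proof.
have mx1 : measurable_vec (fun p : pastType xi k * Xi => xk k p.1).
  by move=> i; exact: measurableT_comp (@measurable_vec_past_iterate k i) measurable_fst.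
apply: measurable_vecB; first by apply: measurable_G => //; exact: measurable_snd.
apply: (measurable_vec_of_lipschitz mx1) => p q; apply: lipschitz_gradl.
  by case: (spdhg_run_feasible k p.1).
by case: (spdhg_run_feasible k q.1).
Qed.

Lemma mean_le_enorm_sqr_gradient_noise (k : nat) :
  mean_le P (fun w => enorm (gradient_noise k w) ^+ 2) v.
Proof.
apply: (mean_le_enorm_sqr_independent_pair (@indep_past_next k)
  (@measurable_past_next_noise k)) => w.
by have [/oracleP[_ +] _] := spdhg_run_feasible k w.
Qed.

Lemma mean_le_dotv_gradient_noise (k : nat) :
  mean_le P (fun w => dotv (gradient_noise k w) (xs - xk k w)) 0.
Proof.
have measurable_dir : measurable_vec (fun w : pastType xi k => xs - xk k w).
  by apply: measurable_vecB; [exact: measurable_vec_cst|exact: measurable_vec_past_iterate].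
apply: (mean_le_dotv_independent_pair (@indep_past_next k) (@measurable_past_next_noise k)
    _ (@mean_le_enorm_sqr_gradient_noise k) measurable_dir (B := Dx)) => w; last first.
  by have [Xx _] := spdhg_run_feasible k w; exact: diamX.
move=> i; have [/oracleP[/(_ i)[/Lfun1_integrable LG EG] _] _] := spdhg_run_feasible k w.
under eq_fun do rewrite !mxE; have Lc := Lfun_cst mu (- gradl (xk k w) i 0) 1.
split; first exact: rpredD.
by rewrite (expectationD LG Lc) EG expectation_cst -EFinD subrr.
Qed.

Lemma spdhg_run_avg_feasible (t : nat) w :
  X (avg (xk^~ w) t) /\ Y (avg (yk^~ w) t).
Proof.
by split; apply: convex_set_avg => // k; case: (spdhg_run_feasible k.+1 w).
Qed.

Lemma measurable_spdhg_gap (t : nat) :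
  measurable_fun setT (fun w => saddle_gap loss F ys xs (avg (yk^~ w) t) (avg (xk^~ w) t)).
Proof.
have mxy k : measurable_vec (xk k) /\ measurable_vec (yk k).
  apply: (measurable_spdhg_run run); first by rewrite xk0; exact: measurable_vec_cst.
    by rewrite yk0; exact: measurable_vec_cst.
  by move=> j _; exact: indep_xi.1.
have mxa : measurable_vec (fun w => avg (xk^~ w) t).
  by apply: measurable_vec_avg => k; case: (mxy k).
have mya : measurable_vec (fun w => avg (yk^~ w) t).
  by apply: measurable_vec_avg => k; case: (mxy k).
apply: measurable_funB; apply: measurable_funD => //; last first.
- by apply: measurable_dotv => //; exact: measurable_vec_cst.
- apply: measurable_dotv; first exact: measurable_vec_cst.
  exact: measurable_vec_mulmx.
apply: (measurable_comp_continuous mxa (f := loss)) => w; apply: differentiable_continuous.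
by have [/gradlP[]] := spdhg_run_avg_feasible t w.
Qed.

Hypothesis saddle : forall y x, Y y -> X x ->
  Psad loss F y xs <= Psad loss F ys xs <= Psad loss F ys x.

Lemma spdhg_gap_ge0 (t : nat) w :
  0 <= saddle_gap loss F ys xs (avg (yk^~ w) t) (avg (xk^~ w) t).
Proof.
have [Xa Ya] := spdhg_run_avg_feasible t w.
by have /andP[le1 le2] := saddle Ya Xa; rewrite subr_ge0 (le_trans le1).
Qed.

Lemma spdhg_expected_gap_le (t : nat) :
  ('E_P[fun w => saddle_gap loss F ys xs (avg (yk^~ w) t) (avg (xk^~ w) t)] <=
    (t.+1%:R^-1 * ((r t + L) / 2 * Dx ^+ 2 + (2 * s)^-1 * Dy ^+ 2
      + (v + lam * Dy ^+ 2) * \sum_(k < t.+1) (r k)^-1))%:E)%E.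
Proof.
pose C := (r t + L) / 2 * Dx ^+ 2 + (2 * s)^-1 * Dy ^+ 2.
apply: (@expectation_le_mean_le _ _ _ _ _ (fun w => (C + \sum_(k < t.+1)
    ((enorm (gradient_noise k w) ^+ 2 + lam * Dy ^+ 2) / r k
     + dotv (gradient_noise k w) (xs - xk k w))) * t.+1%:R^-1)); first exact: measurable_spdhg_gap.
  move=> w; rewrite spdhg_gap_ge0 mulrC.
  apply: (spdhg_gap_le (g := fun k => G (xk k w) (xi k.+1 w)) (xk := xk^~ w)
    (yk := yk^~ w)) => [||k]; [by rewrite xk0|by rewrite yk0|exact: run].
rewrite [t.+1%:R^-1 * _]mulrC; apply: mean_leMr; first by rewrite invr_ge0.
apply: mean_leD; first exact: mean_le_cst.
rewrite mulr_sumr; apply: mean_le_sum => k; rewrite -[(v + _) / _]addr0.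
apply: mean_leD; last exact: mean_le_dotv_gradient_noise.
apply: mean_leMr; first by rewrite invr_ge0 ltW.
exact: mean_leD (mean_le_enorm_sqr_gradient_noise k) (mean_le_cst _ _).
Qed.

End Spdhg.

Lemma beta_stepE {R : realType} (L : R) (k : nat) :
  beta_step L k = (Num.sqrt k.+1%:R + L)^-1.
Proof. by rewrite /beta_step mul1r. Qed.

Lemma sqrt_step_rate_le {R : realType} (t : nat) (Dx Dy lam L s sigma : R) :
  0 < s -> 0 <= lam ->
  t.+1%:R^-1 * ((Num.sqrt t.+1%:R + L) / 2 * Dx ^+ 2 + (2 * s)^-1 * Dy ^+ 2
      + (sigma ^+ 2 + lam * Dy ^+ 2) * \sum_(k < t.+1) (Num.sqrt k.+1%:R)^-1)
  <= Dy ^+ 2 / (2 * s * t.+1%:R) + L * Dx ^+ 2 / (2 * t.+1%:R)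
     + (Dx ^+ 2 + 2 * lam * Dy ^+ 2 + 2 * sigma ^+ 2) / Num.sqrt t.+1%:R.
Proof.
move=> s0 lam0; have noise_ge0 : 0 <= sigma ^+ 2 + lam * Dy ^+ 2.
  by rewrite addr_ge0 ?sqr_ge0 // mulr_ge0 ?sqr_ge0.
have := ler_wpM2l noise_ge0 (sum_invsqrt_le t.+1).
move: (\sum_(k < _) _) => S S_le.
have q0 : 0 < Num.sqrt t.+1%:R :> R by rewrite sqrtr_gt0.
have qE : t.+1%:R = Num.sqrt t.+1%:R ^+ 2 :> R by rewrite sqr_sqrtr.
move: S_le q0 qE; move: (t.+1%:R : R) (Num.sqrt _) => n q S_le q0 ->.
have slack : 0 <= Dx ^+ 2 / (2 * q) by rewrite divr_ge0 ?sqr_ge0 // mulr_ge0 // ltW.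
have q2_ge0 : 0 <= (q ^+ 2)^-1 by rewrite invr_ge0 sqr_ge0.
rewrite mulrDr; apply: le_trans (lerD (lexx _) (ler_wpM2l q2_ge0 S_le)) _.
rewrite -subr_ge0; apply: le_trans slack _; rewrite le_eqVlt; apply/orP; left; apply/eqP.
by field; rewrite !gt_eqF.
Qed.

Theorem theorem1 (R : realType) (d l : nat)
  (X : set 'cV[R]_d) (Y : set 'cV[R]_l) (Dx Dy : R)
  (F : 'M[R]_(l, d)) (lam : R)
  (loss : 'cV[R]_d -> R) (gradl : 'cV[R]_d -> 'cV[R]_d) (L : R)
  (dX : measure_display) (Xi : measurableType dX) (mu : probability Xi R)
  (G : 'cV[R]_d -> Xi -> 'cV[R]_d) (sigma : R)
  (dT : measure_display) (T : measurableType dT) (P : probability T R)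
  (xi : nat -> T -> Xi) (s : R) (x0 : 'cV[R]_d) (y0 : 'cV[R]_l)
  (xk : nat -> T -> 'cV[R]_d) (yk : nat -> T -> 'cV[R]_l)
  (ys : 'cV[R]_l) (xs : 'cV[R]_d) :
  (* the feasible sets *)
  X !=set0 -> convex_set_ X -> compact X ->
  (forall x x', X x -> X x' -> enorm (x - x') <= Dx) ->
  Y !=set0 -> convex_set_ Y -> compact Y ->
  (forall y y', Y y -> Y y' -> enorm (y - y') <= Dy) ->
  (* lam = lambda_max(F^T F) *)
  is_lambda_max (F^T *m F) lam ->
  (* the loss *)
  convex_on X loss ->
  (forall x, X x -> differentiable loss x /\
                    forall v, 'd loss x v = dotv (gradl x) v) ->
  {within X, continuous gradl} ->
  0 <= L ->
  (forall x1 x2, X x1 -> X x2 -> enorm (gradl x1 - gradl x2) <= L * enorm (x1 - x2)) ->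
  (* the stochastic gradient *)
  0 < sigma ->
  jointly_measurable G ->
  (forall x, X x ->
     (forall i, mu.-integrable setT (fun z => (G x z i ord0)%:E) /\
                ('E_mu[(fun z => G x z i ord0)] = (gradl x i ord0)%:E)%E) /\
     ('E_mu[(fun z => (enorm (G x z - gradl x) ^+ 2)%R)] <= (sigma ^+ 2)%R%:E)%E /\
     ('E_mu[(fun z => (expR (enorm (G x z - gradl x) ^+ 2 / sigma ^+ 2))%R)]
        <= (expR 1)%:E)%E) ->
  (* i.i.d. samples with law mu *)
  mutually_independent P xi -> identically_distributed P xi mu ->
  (* SPDHG iterates *)
  0 < s -> X x0 -> Y y0 ->
  xk 0%N = (fun _ => x0) -> yk 0%N = (fun _ => y0) ->
  (forall k w, Y (yk k.+1 w) /\
     forall y, Y y ->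
       Psad loss F y (xk k w) - (2 * s)^-1 * enorm (y - yk k w) ^+ 2
       <= Psad loss F (yk k.+1 w) (xk k w)
          - (2 * s)^-1 * enorm (yk k.+1 w - yk k w) ^+ 2) ->
  (forall k w,
     let v := xk k w - beta_step L k *:
                (G (xk k w) (xi k.+1 w) + F^T *m yk k.+1 w) in
     X (xk k.+1 w) /\ forall z, X z -> enorm (xk k.+1 w - v) <= enorm (z - v)) ->
  (* (ys, xs) is a saddle point *)
  Y ys -> X xs ->
  (forall y x, Y y -> X x ->
     Psad loss F y xs <= Psad loss F ys xs <= Psad loss F ys x) ->
  forall t : nat,
    (0 <= 'E_P[(fun w => (Psad loss F ys (avg (fun k => xk k w) t)
                        - Psad loss F (avg (fun k => yk k w) t) xs)%R)])%E /\
    ('E_P[(fun w => (Psad loss F ys (avg (fun k => xk k w) t)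
                   - Psad loss F (avg (fun k => yk k w) t) xs)%R)]
     <= ((Dy ^+ 2 / (2 * s * t.+1%:R) + L * Dx ^+ 2 / (2 * t.+1%:R)
         + (Dx ^+ 2 + 2 * lam * Dy ^+ 2 + 2 * sigma ^+ 2) / Num.sqrt t.+1%:R)%R%:E))%E.
Proof.
move=> _ cX _ diamX _ cY _ diamY lamF closs gradP _ L0 lipG _ mG oracle indep law s0 Xx0 Yy0.
move=> xk0 yk0 prox proj Yys Xxs saddle t.
pose r k : R := Num.sqrt k.+1%:R.
have r_gt0 k : 0 < r k by rewrite sqrtr_gt0.
have r_ndecr k : r k <= r k.+1 by rewrite ler_wsqrtr // ler_nat.
have run : spdhg_run X Y F L s r G xi xk yk.
  move=> k w; split; last by rewrite -beta_stepE; exact: proj.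
  by have [Yy] := prox k w; exact: prox_ascent_is_projection.
have noise : stochastic_gradient_on X mu G gradl (sigma ^+ 2).
  by move=> x /oracle[mean [variance _]].
have gap_ge0 := spdhg_gap_ge0 cX cY Xx0 Yy0 xk0 yk0 run saddle t.
have gap_le := spdhg_expected_gap_le cX cY lamF closs gradP L0 lipG s0 Yys Xxs diamX diamY
  r_gt0 r_ndecr mG noise indep law Xx0 Yy0 xk0 yk0 run saddle t.
split; first exact: expectation_ge0.
apply: le_trans gap_le _; rewrite lee_fin.
exact: sqrt_step_rate_le (gram_lambda_max_ge0 lamF).
Qed.
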